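(* Let $p$ be a monic real polynomial of degree $d\ge2$ with $p(0)=0$ and $\lambda=p'(0)>1$, and let $f$ be the entire solution of $f(\lambda z)=p(f(z))$ with $f(0)=0$, $f'(0)=1$. Let $w_0\in\mathbb{C}$ be an attracting fixed point of $p$ such that $\mathcal{F}_{w_0}(p)$ contains an angular region $W_{\alpha,\beta}\cap B(0,r)$ for some $r>0$. Then the asymptotic behaviour of $f(z)$ for $z\to\infty$, $z\in W_{\alpha,\beta}$, is given as follows. (i) If $\eta=p'(w_0)\neq0$, then there is a periodic function $H$ of period $1$, holomorphic in some strip, such that for $z\in W_{\alpha,\beta}$ large enough $$f(z)=\Psi^{(-1)}\left(z^{\log_\lambda\eta}H(\log_\lambda z)\right)=w_0+z^{\log_\lambda\eta}H(\log_\lambda z)+\sum_{n=2}^\infty\psi_n z^{n\log_\lambda\eta}\left(H(\log_\lambda z)\right)^n .$$ (ii) If $p(z)-w_0$ has a zero of order $k\geq 2$ at $w_0$, then there is a periodic function $L$ of period $1$ such that, for a suitable choice of the $(k-1)$-th root, $$f(z)=g^{(-1)}\left(A^{-\frac1{k-1}}\exp\left(z^{\log_\lambda k}L(\log_\lambda z)\right)\right)=w_0+A^{-\frac1{k-1}}\exp\left(z^{\log_\lambda k}L(\log_\lambda z)\right)(1+o(1))$$ as $z\to\infty$ in $W_{\alpha,\beta}$.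
   Context: $W_{\alpha,\beta}=\{z\in\mathbb{C}\setminus\{0\}\mid\alpha<\arg z<\beta\}$ and $B(0,r)=\{w\in\mathbb{C}\mid|w|<r\}$. A fixed point $w_0$ of $p$ is attracting if $|p'(w_0)|<1$; its basin of attraction is $\mathcal{F}_{w_0}(p)=\{z\in\mathbb{C}\mid\lim_{n\to\infty}p^{(n)}(z)=w_0\}$, with $p^{(n)}$ the $n$-th iterate of $p$. Here $\log_\lambda z=\log z/\log\lambda$, powers $z^s=\exp(s\log z)$ with $\Im \log z=\arg z\in(\alpha,\beta)$, and $\log_\lambda\eta=\log\eta/\log\lambda$. In (i), $\Psi$ is the solution of the Schröder equation $\eta\Psi(z)=\Psi(p(z))$, $\Psi(w_0)=0$, $\Psi'(w_0)=1$, holomorphic in $\mathcal{F}_{w_0}(p)$; its local inverse around $0$ is $\Psi^{(-1)}(z)=w_0+z+\sum_{n\ge2}\psi_nz^n$. In (ii), write $p(z)-w_0=(z-w_0)^kP(z)$ with $A=P(w_0)\neq0$; $g$ is the solution, holomorphic near $w_0$, of the Böttcher equation $g(p(z))=A(g(z))^k$, $g(w_0)=0$, $g'(w_0)=1$, and $g^{(-1)}$ is its local inverse around $0$.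
   Formalization: ''z large enough'' and ''z→∞ in W'' are taken on each smaller sector α<α'<arg z<β'<β, with a threshold depending on it (f may hit the Julia set on the boundary rays of W); (ii) is claimed only where f(z)≠w0, since its right side is never w0 for large z while f may take that value in W. *)

(* Defs.v *)
From HB Require Import structures.
From mathcomp Require Import all_boot all_order all_algebra.
From mathcomp Require Export complex.
From mathcomp Require Import all_classical all_reals all_analysis.
Set Implicit Arguments.
Unset Strict Implicit.
Unset Printing Implicit Defensive.
Import Order.TTheory GRing.Theory Num.Theory.
Import numFieldNormedType.Exports.
Local Open Scope classical_set_scope.
Local Open Scope complex_scope.
Local Open Scope ring_scope.

(* R[i] as a normed space over itself (scalar multiplication = product of R[i]),
   so that [derivable F z 1] is complex differentiability. *)
HB.instance Definition _ (R : realType) := NormedModule.copy R[i] R[i]^o.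

Definition cderivable (R : realType) (F : R[i] -> R[i]) (z : R[i]) : Prop :=
  derivable F z 1.

Definition has_cderiv (R : realType) (F : R[i] -> R[i]) (z dF : R[i]) : Prop :=
  is_derive z 1 F dF.

Lemma cderivableE (R : realType) (F : R[i] -> R[i]) (z : R[i]) :
  cderivable F z = cvg ((F (h + z) - F z) / h @[h --> 0^']).
Proof.
rewrite /cderivable /derivable.
suff -> : (fun h : R[i] => h^-1 *: ((F \o shift z) (h *: (1 : R[i])) - F z)) =
          (fun h : R[i] => (F (h + z) - F z) / h) by [].
by apply/funext => h; rewrite /= /GRing.scale /= mulr1 mulrC.
Qed.

Definition holomorphic_on (R : realType) (D : set R[i]) (F : R[i] -> R[i]) :=
  forall z, D z -> cderivable F z.

Definition cexp (R : realType) (z : R[i]) : R[i] :=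
  (expR (complex.Re z))%:C * (cos (complex.Im z) +i* sin (complex.Im z)).

Definition strip (R : realType) (a b : R) : set R[i] :=
  [set s | a < complex.Im s < b].

(* z <> 0 with a < arg z < b: some logarithm l of z has Im l = arg z in ]a, b[. *)
Definition sector (R : realType) (a b : R) : set R[i] :=
  @cexp R @` strip a b.

Definition cpoly (R : realType) (p : {poly R}) : {poly R[i]} :=
  map_poly (real_complex R) p.

Definition basin (R : realType) (p : {poly R[i]}) (w0 : R[i]) : set R[i] :=
  [set z | iter n (horner p) z @[n --> \oo] --> w0].

Definition local_inverse (R : realType) (G : R[i] -> R[i]) (w0 : R[i])
    (Ginv : R[i] -> R[i]) : Prop :=
  [/\ Ginv 0 = w0,
      \forall w \near (0 : R[i]), cderivable Ginv w,
      \forall w \near (0 : R[i]), G (Ginv w) = w &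
      \forall z \near w0, Ginv (G z) = z].

(* log_lambda of a number whose chosen logarithm is l. *)
Definition loglam (R : realType) (lambda : R) (l : R[i]) : R[i] :=
  l / (ln lambda)%:C.

(* "Q holds for all large z with a < arg z < b".  Q is a predicate of the
   logarithm l = log z with Im l = arg z in ]a, b[, so that z = cexp l and
   z^s = cexp (s * l).  As usual for asymptotics in an open angular region, the
   threshold for |z| may depend on a smaller angle a' < arg z < b' with
   a < a' and b' < b: the rays arg z = a and arg z = b may meet the Julia set
   of the Poincare function, and then no threshold serves the whole region. *)
Definition large_in_sector (R : realType) (a b : R) (Q : R[i] -> Prop) : Prop :=
  forall a' b' : R, a < a' -> b' < b ->
  exists M : R, forall l : R[i],
    strip a' b' l -> M%:C < `|cexp l| -> Q l.

(* Main.v *)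
(* Since f (lambda^n z) = p^n (f z) and f h ~ h at 0, the orbit of f z for z in
   the open sector passes through points f h with h = lambda^-n z small and
   f h still in the sector, so f maps the whole sector into the basin of w0.
   A compactness argument on the fundamental domain 1 <= |z| <= lambda of a
   smaller closed sector makes the convergence p^n (f z) -> w0 uniform, so
   f tends to w0 there.  Once f z is close to w0, Psi \o f satisfies
   (Psi \o f) (lambda z) = eta (Psi \o f) z, which forces the form
   z^(log eta / log lambda) H; likewise u = (g \o f) / B, with B^(k-1) = 1 / A,
   satisfies u (lambda z) = (u z)^k, and L comes from choosing a logarithm of u
   at one point of each orbit of s |-> s + 1. *)

Require Import Defs.
From mathcomp Require Import all_boot all_order all_algebra.
From mathcomp Require Import ring lra.
From mathcomp Require Import all_classical all_reals all_analysis.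
Set Implicit Arguments.
Unset Strict Implicit.
Unset Printing Implicit Defensive.
Import Order.TTheory GRing.Theory Num.Theory.
Import numFieldNormedType.Exports.
Local Open Scope classical_set_scope.
Local Open Scope complex_scope.
Local Open Scope ring_scope.

Section ComplexExponential.
Variable R : realType.
Implicit Types (z l h : R[i]) (x y e : R).

Lemma cexpE x y : cexp (x +i* y) = (expR x * cos y) +i* (expR x * sin y).
Proof. by rewrite /cexp /=; simpc. Qed.

Lemma cexpD z l : cexp (z + l) = cexp z * cexp l.
Proof.
case: z l => [a b] [c d]; rewrite !cexpE expRD cosD sinD; simpc.
by congr (_ +i* _); ring.
Qed.

Lemma cexp_real x : cexp x%:C = (expR x)%:C :> R[i].
Proof. by rewrite cexpE cos0 sin0 mulr1 mulr0. Qed.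

Lemma cexp0 : cexp 0 = 1 :> R[i].
Proof. by rewrite (cexp_real 0) expR0. Qed.

Lemma cexpN z : cexp (- z) = (cexp z)^-1.
Proof.
have h : cexp z * cexp (- z) = 1 by rewrite -cexpD subrr cexp0.
have z0 : cexp z != 0.
  by apply/eqP => z0; move: h; rewrite z0 mul0r => /esym/eqP; rewrite oner_eq0.
by apply: (mulfI z0); rewrite h divff.
Qed.

Lemma cexp_neq0 z : cexp z != 0.
Proof.
apply/eqP => z0; have := cexpD z (- z).
by rewrite z0 mul0r subrr cexp0 => /eqP; rewrite oner_eq0.
Qed.

Lemma cexpMn n z : cexp (n%:R * z) = cexp z ^+ n.
Proof.
elim: n => [|n ih]; first by rewrite mul0r cexp0 expr0.
by rewrite exprS -ih -cexpD -natr1 mulrDl mul1r addrC.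
Qed.

Lemma norm_cexp z : `|cexp z| = (expR (complex.Re z))%:C.
Proof.
case: z => a b; rewrite cexpE normc_def /= !exprMn -mulrDr cos2Dsin2 mulr1.
by rewrite sqrtr_sqr ger0_norm // expR_ge0.
Qed.

Lemma le_norm_ReIm z :
  `|z| <= (`|complex.Re z| + `|complex.Im z|)%:C.
Proof.
case: z => a b; rewrite normc_def lecR /=.
rewrite -[leRHS]ger0_norm ?addr_ge0 // -sqrtr_sqr ler_sqrt ?sqr_ge0 //.
rewrite sqrrD !real_normK ?num_real //.
by rewrite [leRHS]addrAC lerDl mulrn_wge0 // mulr_ge0.
Qed.

Lemma Im_le_norm z : `|complex.Im z|%:C <= `|z|.
Proof.
case: z => a b; rewrite normc_def lecR /= -sqrtr_sqr ler_sqrt ?addr_ge0 ?sqr_ge0 //.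
by rewrite lerDr sqr_ge0.
Qed.

Lemma Re_norm_norm z : (complex.Re `|z|)%:C = `|z|.
Proof. by rewrite RRe_real // normr_real. Qed.

Lemma cexp_surj z : z != 0 -> exists l, cexp l = z.
Proof.
move=> z0; set m := complex.Re `|z|.
have mE : m%:C = `|z| by exact: Re_norm_norm.
have m0 : 0 < m by rewrite -ltcR mE normr_gt0.
case: z z0 @m mE m0 => a b z0 m mE m0.
have abE : a ^+ 2 + b ^+ 2 = m ^+ 2.
  apply: complexI; have := add_Re2_Im2 (a +i* b); rewrite -mE /= => ->.
  by rewrite rmorphXn.
pose c := a / m; pose s := b / m.
have cs : c ^+ 2 + s ^+ 2 = 1.
  by rewrite /c /s !expr_div_n -mulrDl abE divff // expf_eq0 /= gt_eqF.
have c1 : -1 <= c <= 1.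
  rewrite -ler_norml -(ler_pXn2r (n := 2)) ?nnegrE // expr1n real_normK ?num_real //.
  by rewrite -cs lerDl sqr_ge0.
have sE : sin (acos c) = `|s|.
  by rewrite sin_acos // -cs addrAC subrr add0r sqrtr_sqr.
have aE : m * c = a by rewrite /c mulrC divfK // gt_eqF.
have bE : m * s = b by rewrite /s mulrC divfK // gt_eqF.
have [s0|s0] := leP 0 s.
  exists (ln m +i* acos c); rewrite cexpE lnK // acosK; last by rewrite in_itv.
  by rewrite sE ger0_norm // aE bE.
exists (ln m +i* - acos c); rewrite cexpE lnK // cosN sinN acosK; last by rewrite in_itv.
by rewrite sE ltr0_norm // opprK aE bE.
Qed.

Lemma near_complexP (P : R[i] -> Prop) z :
  (exists2 e, 0 < e & forall w, `|w - z| < e%:C -> P w) <->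
  \forall w \near z, P w.
Proof.
split=> [[e e0 eP]|/nbhs_normP [/= e e0 eP]].
  apply/nbhs_normP; exists e%:C; first by rewrite /= ltcR.
  by move=> w /=; rewrite distrC => /eP.
have eE : (complex.Re e)%:C = e by rewrite RRe_real // gtr0_real.
exists (complex.Re e); first by rewrite -ltcR eE.
by move=> w; rewrite eE distrC => /eP.
Qed.

End ComplexExponential.

Lemma is_derive1P (K : numFieldType) (F : K -> K) (z D : K) : is_derive z 1 F D <->
  forall e, 0 < e -> \forall w \near z, `|F w - F z - D * (w - z)| <= e * `|w - z|.
Proof.
have qE (h : K) : h != 0 -> D - h^-1 *: ((F \o shift z) (h *: (1 : K)) - F z) =
    - h^-1 * (F (h + z) - F z - D * (h + z - z)).
  by move=> h0; rewrite /= /GRing.scale /= mulr1; field.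
have eqv : (forall e, 0 < e ->
    \forall w \near z, `|F w - F z - D * (w - z)| <= e * `|w - z|) <->
    h^-1 *: ((F \o shift z) (h *: (1 : K)) - F z) @[h --> 0^'] --> D.
  split=> [Hn|/cvgrPdist_le Hc e e0].
    apply/cvgrPdist_le => e e0; have /nbhs_normP [/= m m0 mP] := Hn _ e0.
    rewrite near_withinE; apply/nbhs_normP; exists m => // h /=.
    rewrite sub0r normrN => hm h0; rewrite qE // normrM normrN normfV mulrC.
    rewrite ler_pdivrMr ?normr_gt0 //.
    by have := mP (h + z); rewrite /= distrC addrK => /(_ hm).
  have := Hc e e0; rewrite near_withinE => /nbhs_normP [/= m m0 mP].
  apply/nbhs_normP; exists m => // w; rewrite /= distrC => wm.
  have [->|wz] := eqVneq w z; first by rewrite !subrr mulr0 subrr !normr0 mulr0.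
  have h0 : w - z != 0 by rewrite subr_eq0.
  have := mP (w - z); rewrite /= sub0r normrN => /(_ wm h0).
  by rewrite qE // normrM normrN normfV mulrC ler_pdivrMr ?normr_gt0 // !subrK.
rewrite eqv; split=> [[Fz <-]|Hc]; first exact: Fz.
by apply: DeriveDef; [apply/cvg_ex; exists D | exact: cvg_lim].
Qed.

Lemma derivable1_continuous (K : numFieldType) (F : K -> K) (z : K) :
  derivable F z 1 -> {for z, continuous F}.
Proof. by move=> /derivable1_diffP; exact: differentiable_continuous. Qed.

Lemma derivable1_comp (K : numFieldType) (F G : K -> K) (z : K) :
  derivable F z 1 -> derivable G (F z) 1 -> derivable (G \o F) z 1.
Proof.
by move=> /derivable1_diffP Fz /derivable1_diffP Gz; apply/derivable1_diffP;
  exact: differentiable_comp.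
Qed.

Section ComplexDerivative.
Variable R : realType.
Implicit Types (F G : R[i] -> R[i]) (z D : R[i]) (e : R).

Lemma has_cderivP F z D : has_cderiv F z D <->
  forall e, 0 < e ->
    \forall w \near z, `|F w - F z - D * (w - z)| <= e%:C * `|w - z|.
Proof.
split=> [/is_derive1P Fz e e0|Fz]; first by apply: Fz; rewrite ltcR.
apply/is_derive1P => e e0.
have eE : (complex.Re e)%:C = e by rewrite RRe_real // gtr0_real.
by rewrite -eE; apply: Fz; rewrite -ltcR eE.
Qed.

Lemma has_cderiv_cderivable F z D : has_cderiv F z D -> cderivable F z.
Proof. by case. Qed.

Lemma cderivable_continuous F z : cderivable F z -> {for z, continuous F}.
Proof. exact: derivable1_continuous. Qed.

Lemma cderivable_comp F G z :
  cderivable F z -> cderivable G (F z) -> cderivable (G \o F) z.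
Proof. exact: derivable1_comp. Qed.

Lemma cderivableM F G z :
  cderivable F z -> cderivable G z -> cderivable (fun w => F w * G w) z.
Proof. exact: derivableM. Qed.

Lemma cderivable_scale D z : cderivable (fun w => D * w) z.
Proof.
apply: (@has_cderiv_cderivable _ _ D); apply/has_cderivP => e e0.
by near=> w; rewrite -mulrBr subrr normr0 mulr_ge0 // ler0c ltW.
Unshelve. all: by end_near. Qed.

Lemma near_Re_Im (P Q : R -> Prop) :
  (\forall x \near (0 : R), P x) -> (\forall y \near (0 : R), Q y) ->
  \forall h \near (0 : R[i]), P (complex.Re h) /\ Q (complex.Im h).
Proof.
move=> /nbhs_normP [/= a a0 aP] /nbhs_normP [/= b b0 bP].
apply/near_complexP; exists (Num.min a b); first by rewrite lt_min a0.
move=> h; rewrite subr0 => hab; split.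
  apply: aP; rewrite /= sub0r normrN -ltcR (le_lt_trans (normc_ge_Re h)) //.
  by rewrite (lt_le_trans hab) // lecR ge_min lexx.
apply: bP; rewrite /= sub0r normrN -ltcR (le_lt_trans (Im_le_norm h)) //.
by rewrite (lt_le_trans hab) // lecR ge_min lexx orbT.
Qed.

Lemma has_cderiv_cexp0 : has_cderiv (@cexp R) 0 1.
Proof.
apply/has_cderivP => e e0; pose d := Num.min (e / 16) 1.
have d0 : 0 < d by rewrite lt_min ltr01 andbT divr_gt0.
have d1 : d <= 1 by rewrite ge_min lexx orbT.
have de : d * 16 <= e by rewrite -ler_pdivlMr // ge_min lexx.
have /is_derive1P/(_ d d0) Ex := is_derive_expR (0 : R).
have /is_derive1P/(_ d d0) Cx := is_derive_cos (0 : R).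
have /is_derive1P/(_ d d0) Sx := is_derive_sin (0 : R).
have h1 : \forall x \near (0 : R), `|x| < d.
  by apply/nbhs_normP; exists d => // x; rewrite /= sub0r normrN.
have /near_complexP [m m0 mP] := near_Re_Im (@filterI _ _ (nbhs_filter _) _ _ Ex h1)
  (@filterI _ _ (nbhs_filter _) _ _ Cx Sx).
apply/near_complexP; exists m => // -[x y] /mP /= [[ex xd] [cy sy]] {m m0 mP}.
move: ex cy sy; rewrite cexp0 cexpE expR0 cos0 sin0 !subr0 !(oppr0,mul0r,subr0,mul1r).
set u := expR x; set c := cos y; set s := sin y => ex cy sy.
have u1 : `|u - 1| <= 2 * d.
  have -> : u - 1 = (u - 1 - x) + x by ring.
  rewrite (le_trans (ler_normD _ _)) //; have : d * `|x| <= 1 * `|x| by rewrite ler_wpM2r.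
  by move: ex xd; lra.
have u3 : `|u| <= 3.
  by have := ler_normD (u - 1) 1; rewrite subrK normr1; move: u1 d1; lra.
have reB : `|u * c - 1 - x| <= 3 * (d * `|y|) + d * `|x|.
  have -> : u * c - 1 - x = u * (c - 1) + (u - 1 - x) by ring.
  by rewrite (le_trans (ler_normD _ _)) // lerD // normrM ler_pM.
have imB : `|u * s - y| <= 3 * (d * `|y|) + 2 * d * `|y|.
  have -> : u * s - y = u * (s - y) + (u - 1) * y by ring.
  by rewrite (le_trans (ler_normD _ _)) // lerD // normrM ler_pM.
have -> : u * c +i* (u * s) - 1 - (x +i* y) = (u * c - 1 - x) +i* (u * s - y).
  by simpc.
apply: (le_trans (le_norm_ReIm _)).
have := normc_ge_Re (x +i* y); have := Im_le_norm (x +i* y).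
rewrite -(Re_norm_norm (x +i* y)); set N := complex.Re `|_|.
rewrite -rmorphM !lecR => hy hx; rewrite [complex.Re (_ +i* _)]/= in hx.
rewrite [complex.Im (_ +i* _)]/= in hy; rewrite ![complex.Re (_ +i* _)]/= ![complex.Im (_ +i* _)]/=.
have [x0 y0] : 0 <= `|x| /\ 0 <= `|y| by [].
have dx : d * `|x| <= d * N by rewrite ler_wpM2l // ltW.
have dy : d * `|y| <= d * N by rewrite ler_wpM2l // ltW.
have : d * 16 * N <= e * N.
  by rewrite ler_wpM2r // (le_trans x0).
have := mulr_ge0 (ltW d0) x0; move: reB imB; lra.
Qed.

Lemma has_cderiv_cexp z : has_cderiv (@cexp R) z (cexp z).
Proof.
apply/has_cderivP => e e0.
have /has_cderivP := has_cderiv_cexp0.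
set n := complex.Re `|cexp z|; have nE : n%:C = `|cexp z| by exact: Re_norm_norm.
have n0 : 0 < n by rewrite -ltcR nE normr_gt0 cexp_neq0.
move=> /(_ (e / n)); rewrite divr_gt0 // => /(_ isT) /near_complexP [m m0 mP].
apply/near_complexP; exists m => // w wm.
have := mP (w - z); rewrite !subr0 cexp0 => /(_ wm).
have -> : cexp w - cexp z - cexp z * (w - z) = cexp z * (cexp (w - z) - 1 - 1 * (w - z)).
  by rewrite -[w in cexp w](subrK z) cexpD; ring.
rewrite normrM -nE => h.
have -> : e%:C * `|w - z| = n%:C * ((e / n)%:C * `|w - z|).
  have nn : n != 0 by rewrite gt_eqF.
  have en : n * (e / n) = e by field.
  by rewrite mulrA -[in LHS]en rmorphM.
by rewrite ler_pM2l // ltcR.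
Qed.

Lemma cderivable_cexp z : cderivable (@cexp R) z.
Proof. exact: has_cderiv_cderivable (has_cderiv_cexp z). Qed.

End ComplexDerivative.

Lemma is_derive_horner (K : numFieldType) (p : {poly K}) (x : K) :
  is_derive x 1 (horner p) p^`().[x].
Proof.
elim/poly_ind: p => [|p c ih].
  rewrite deriv0 horner0 (_ : horner 0 = cst 0); first exact: is_derive_cst.
  by apply/funext => y; rewrite horner0.
rewrite (_ : horner _ = horner p * id + cst c); last first.
  by apply/funext => y; rewrite !hornerE.
apply: is_derive_eq; rewrite derivD derivM derivX derivC !hornerE /GRing.scale /=.
by ring.
Qed.

Section Dynamics.
Variable R : realType.
Implicit Types (z w l q : R[i]) (e : R).

Lemma cderivable_horner (p : {poly R[i]}) z : cderivable (horner p) z.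
Proof. exact: has_cderiv_cderivable (is_derive_horner p z). Qed.

Lemma cderivable_iter (F : R[i] -> R[i]) n z :
  (forall w, cderivable F w) -> cderivable (iter n F) z.
Proof.
move=> Fd; elim: n => [|n ih].
  by rewrite (_ : iter 0 F = id) //; exact: derivable_id.
exact: (@cderivable_comp _ (iter n F) F z ih (Fd _)).
Qed.

Lemma near1_cexp e : 0 < e ->
  \forall q \near (1 : R[i]), exists2 l, cexp l = q & `|complex.Im l| < e.
Proof.
move=> e0.
have /(@cvgrPdist_lt _ _)/(_ e e0) := @continuous_atan R 0.
rewrite atan0 => /nbhs_normP [/= m m0 mP].
apply/near_complexP; exists (Num.min (1 / 2) (m / 2)); first by rewrite lt_min !divr_gt0.
move=> [a b] ab.
have := le_lt_trans (normc_ge_Re _) ab; have := le_lt_trans (Im_le_norm _) ab.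
rewrite !ltcR !lt_min /= subr0 => /andP [b1 bm] /andP [a1 _].
have a0 : 1 / 2 < a by move: a1; rewrite ltr_norml => /andP [? _]; lra.
have a00 : 0 < a by lra.
pose t := b / a; pose c := cos (atan t).
have c0 : 0 < c by rewrite /c cos_atan invr_gt0 sqrtr_gt0 ltr_pwDl // sqr_ge0.
have sE : sin (atan t) = t * c by rewrite -[in RHS](atanK t) /tan divfK // gt_eqF.
exists (ln (a / c) +i* atan t).
  rewrite cexpE lnK ?posrE ?divr_gt0 // sE -/c.
  by congr (_ +i* _); rewrite /t; field; rewrite !gt_eqF.
rewrite /= -normrN -sub0r; apply: mP; rewrite /= sub0r normrN normrM normfV.
rewrite (gtr0_norm a00) ltr_pdivrMr // (lt_le_trans bm) // ler_pM2l //; lra.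
Qed.

Lemma near_invariant_ball (F : R[i] -> R[i]) w0 D (U : R[i] -> Prop) :
  F w0 = w0 -> has_cderiv F w0 D -> `|D| < 1 -> (\forall w \near w0, U w) ->
  exists2 e, 0 < e & forall w, `|w - w0| < e%:C -> U w /\ `|F w - w0| < e%:C.
Proof.
move=> Fw0 /has_cderivP Fd D1 /near_complexP [e1 e10 e1P].
pose m := complex.Re `|D|; have mE : m%:C = `|D| by exact: Re_norm_norm.
have m1 : 0 < 1 - m by rewrite subr_gt0 -ltcR mE.
have /near_complexP [e2 e20 e2P] := Fd _ m1.
exists (Num.min e1 e2); first by rewrite lt_min e10.
move=> w wm.
have w1 : `|w - w0| < e1%:C by rewrite (lt_le_trans wm) // lecR ge_min lexx.
have w2 : `|w - w0| < e2%:C by rewrite (lt_le_trans wm) // lecR ge_min lexx orbT.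
split; first exact: e1P.
apply: le_lt_trans wm.
have -> : F w - w0 = (F w - F w0 - D * (w - w0)) + D * (w - w0) by rewrite Fw0; ring.
rewrite (le_trans (ler_normD _ _)) // normrM -mE.
have := e2P _ w2; rewrite rmorphB mulrBl mul1r; move: `|_ - _ - _| => u.
by rewrite lerBrDr.
Qed.

End Dynamics.

Lemma near_continuous_dist (R : realType) (F : R[i] -> R[i]) z w0 (e : R) :
  {for z, continuous F} -> `|F z - w0| < e%:C ->
  \forall w \near z, `|F w - w0| < e%:C.
Proof.
move=> /cvgrPdist_lt Fc; rewrite -subr_gt0 => /Fc.
move=> /near_complexP [m m0 mP]; apply/near_complexP; exists m => // w /mP.
rewrite distrC ltrBrDr => /(le_lt_trans _); apply.
by rewrite (le_trans _ (ler_normD _ _)) // addrA subrK.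
Qed.

Lemma near_continuous_comp (R : realType) (F : R[i] -> R[i]) z (Q : R[i] -> Prop) :
  {for z, continuous F} -> (\forall w \near F z, Q w) -> \forall w \near z, Q (F w).
Proof. by move=> Fc; exact: Fc. Qed.

Section PoincareFunction.
Variables (R : realType) (P : {poly R[i]}) (lambda : R) (f : R[i] -> R[i]).
Variables (w0 : R[i]) (alpha beta r : R).
Hypothesis lambda1 : 1 < lambda.
Hypothesis f_entire : holomorphic_on setT f.
Hypothesis f_eq : forall z, f (lambda%:C * z) = P.[f z].
Hypothesis f0 : f 0 = 0.
Hypothesis f1 : has_cderiv f 0 1.
Hypothesis Pw0 : P.[w0] = w0.
Hypothesis P_attr : `|P^`().[w0]| < 1.
Hypothesis r0 : 0 < r.
Hypothesis sector_basin : forall z : R[i],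
  sector alpha beta z -> `|z| < r%:C -> basin P w0 z.

Lemma ln_lambda_gt0 : 0 < ln lambda.
Proof. exact: ln_gt0. Qed.

Lemma cexpD_ln (l : R[i]) : cexp (l + (ln lambda)%:C) = lambda%:C * cexp l.
Proof. by rewrite cexpD cexp_real lnK ?posrE ?(lt_trans ltr01) // mulrC. Qed.

Lemma f_cexpD (l : R[i]) n :
  f (cexp (l + (n%:R * ln lambda)%:C)) = iter n (horner P) (f (cexp l)).
Proof.
elim: n => [|n ih]; first by rewrite mul0r addr0.
by rewrite -natr1 mulrDl mul1r rmorphD addrA cexpD_ln f_eq ih.
Qed.

Lemma basin_iter n z : basin P w0 z -> basin P w0 (iter n (horner P) z).
Proof.
move=> Bz; rewrite /basin /=.
have := Bz; rewrite /basin /= -(cvg_shiftn n).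
by under eq_fun do rewrite iterD.
Qed.

Lemma sector_f_basin l : strip alpha beta l -> basin P w0 (f (cexp l)).
Proof.
case/andP => al lb.
pose e := Num.min (complex.Im l - alpha) (beta - complex.Im l).
have e0 : 0 < e by rewrite lt_min !subr_gt0 al.
have /near_complexP [m1 m10 m1P] := near1_cexp e0.
have m1h : 0 < m1 / 2 by rewrite divr_gt0.
have /has_cderivP /(_ _ m1h) /near_complexP [m2 m20 m2P] := f1.
have /cderivable_continuous fc := f_entire (z := 0) I.
have /near_complexP [m3 m30 m3P] : \forall h \near (0 : R[i]), `|f h| < r%:C.
  have /cvgr_norm_lt := fc; apply; rewrite f0 normr0 ltcR //.
pose m := Num.min m2 m3; have m0 : 0 < m by rewrite lt_min m20.
pose n := Num.bound ((complex.Re l - ln m) / ln lambda).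
have nP : complex.Re l - n%:R * ln lambda < ln m.
  rewrite ltrBlDl -ltrBlDr -ltr_pdivrMr ?ln_lambda_gt0 //.
  exact: unstable.ltr_bound.
pose l' := l - (n%:R * ln lambda)%:C; pose h := cexp l'.
have lE : l = l' + (n%:R * ln lambda)%:C by rewrite subrK.
have hm : `|h| < m%:C.
  rewrite norm_cexp ltcR -[ltRHS]lnK ?posrE // ltr_expR.
  by move: nP; rewrite /l'; case: (l).
have h0 : h != 0 by exact: cexp_neq0.
have hm2 : `|h| < m2%:C by rewrite (lt_le_trans hm) // lecR ge_min lexx.
have hm3 : `|h| < m3%:C by rewrite (lt_le_trans hm) // lecR ge_min lexx orbT.
rewrite {1}lE f_cexpD; apply: basin_iter; apply: sector_basin; last first.
  by apply: m3P; rewrite subr0.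
have [u uE ue] : exists2 u, cexp u = f h / h & `|complex.Im u| < e.
  apply: m1P; have := m2P h; rewrite !subr0 f0 mul1r subr0 => /(_ hm2).
  rewrite (_ : f h - h = (f h / h - 1) * h); last by field.
  rewrite normrM ler_pM2r ?normr_gt0 // => /le_lt_trans; apply.
  by rewrite ltcR ltr_pdivrMr // ltr_pMr // ltrDl.
exists (l' + u); last by rewrite cexpD uE mulrC divfK.
move: ue; rewrite lt_min !ltr_norml /strip /= /l'.
case: (l) al lb => a b /= al lb; case: (u) => c d /=; rewrite /e /= oppr0 addr0.
by move=> /andP [/andP [? ?] /andP [? ?]]; apply/andP; split; lra.
Qed.

Lemma large_in_sector_near (U : R[i] -> Prop) : (\forall w \near w0, U w) ->
  large_in_sector alpha beta (fun l => U (f (cexp l))).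
Proof.
move=> Unear a b alphaa bbeta.
have [e e0 eP] := near_invariant_ball Pw0 (is_derive_horner P w0) P_attr Unear.
have inv n m w : (n <= m)%N -> `|iter n (horner P) w - w0| < e%:C ->
    `|iter m (horner P) w - w0| < e%:C.
  by move=> /subnK <-; elim: (m - n)%N => // k ih /ih /eP [].
pose L := ln lambda; have L0 : 0 < L by exact: ln_lambda_gt0.
pose F n (t : R * R) := forall m, (n <= m)%N ->
  `|iter m (horner P) (f (cexp (t.1 +i* t.2))) - w0| < e%:C.
have /compact_near_coveringP cov : compact (`[0, L] `*` `[a, b] : set (R * R)).
  by apply: compact_setX; exact: segment_compact.
have {cov} /cov : forall t, (`[0, L] `*` `[a, b]) t ->
    \forall u \near t & n \near \oo, F n u.
  move=> [x y] [/= _]; rewrite in_itv /= => /andP [ay yb].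
  have xyB : basin P w0 (f (cexp (x +i* y))).
    by apply: sector_f_basin; rewrite /strip /= (lt_le_trans alphaa) // (le_lt_trans yb).
  have G n : {for (x +i* y), continuous (iter n (horner P) \o (f \o @cexp R))}.
    apply: cderivable_continuous; apply: cderivable_comp.
      by apply: cderivable_comp; [exact: cderivable_cexp|exact: f_entire].
    by apply: cderivable_iter => w; exact: cderivable_horner.
  have [N _ NP] : \forall n \near \oo, `|iter n (horner P) (f (cexp (x +i* y))) - w0| < e%:C.
    have /cvgrPdist_lt/(_ e%:C) := xyB; rewrite ltcR => /(_ e0).
    by apply: filterS => n; rewrite distrC.
  have /near_complexP [m m0 mP] : \forall l \near (x +i* y),
      `|iter N (horner P) (f (cexp l)) - w0| < e%:C.
    by apply: (near_continuous_dist (G N)); exact: NP N (leqnn N).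
  exists ([set u | `|u.1 - x| < m / 2 /\ `|u.2 - y| < m / 2], [set n | (N <= n)%N]).
    split=> /=; last exact: nbhs_infty_ge.
    exists ([set u | `|u - x| < m / 2], [set u | `|u - y| < m / 2]).
      by split=> /=; apply/nbhs_normP; exists (m / 2); rewrite /= ?divr_gt0 // => u;
        rewrite /= distrC.
    by move=> u [].
  move=> [[x' y'] n] [/= [xx yy] Nn] k nk; apply: (inv N); first exact: leq_trans nk.
  apply: mP; apply: (le_lt_trans (le_norm_ReIm _)); rewrite ltcR /=; lra.
case=> N _ NP; exists (expR (N%:R * L)) => -[x y] /andP [/= ay yb].
rewrite norm_cexp ltcR ltr_expR /= => Nx.
have x0 : 0 <= x / L by rewrite divr_ge0 // ltW // (le_lt_trans _ Nx) // mulr_ge0 // ltW.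
have /andP [k1 k2] := truncn_itv x0; set k := Num.trunc (x / L) in k1 k2.
have kN : (N <= k)%N by rewrite truncn_ge_nat // ler_pdivlMr // ltW.
move: k1 k2; rewrite ler_pdivlMr // ltr_pdivrMr // -natr1 mulrDl mul1r => k1 k2.
have -> : x +i* y = ((x - k%:R * L) +i* y) + (k%:R * L)%:C by simpc; rewrite subrK.
rewrite f_cexpD; apply: (eP _ _).1.
apply: (NP N (leqnn N) ((x - k%:R * L), y)) => //.
by split; rewrite /= in_itv /= ?(ltW ay) ?(ltW yb) // subr_ge0 k1 lerBlDl addrC ltW //= addrC.
Qed.

Lemma strip_scale s : strip (alpha / ln lambda) (beta / ln lambda) s ->
  strip alpha beta ((ln lambda)%:C * s).
Proof.
case: s => x y; rewrite /strip /= mul0r addr0.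
by rewrite ltr_pdivrMr ?ltr_pdivlMr ?ln_lambda_gt0 // ![y * _]mulrC.
Qed.

Lemma ln_lambda_neq0 : (ln lambda)%:C != 0 :> R[i].
Proof. by rewrite -(rmorph0 (real_complex R)) (inj_eq (@complexI R)) gt_eqF // ln_lambda_gt0. Qed.

Lemma ln_lambdaMloglam l : (ln lambda)%:C * loglam lambda l = l.
Proof. by rewrite /loglam mulrC divfK // ln_lambda_neq0. Qed.

Lemma poincare_schroeder (eta logeta : R[i]) (Psi Psiinv : R[i] -> R[i])
    (psi : nat -> R[i]) :
  cexp logeta = eta ->
  holomorphic_on (basin P w0) Psi ->
  (forall z : R[i], basin P w0 z -> eta * Psi z = Psi P.[z]) ->
  Psi w0 = 0 ->
  has_cderiv Psi w0 1 ->
  local_inverse Psi w0 Psiinv ->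
  (\forall w \near (0 : R[i]),
    series (fun n => psi n.+2 * w ^+ n.+2) @ \oo --> Psiinv w - (w0 + w)) ->
  exists H : R[i] -> R[i],
    [/\ holomorphic_on (strip (alpha / ln lambda) (beta / ln lambda)) H,
        (forall s : R[i], strip (alpha / ln lambda) (beta / ln lambda) s ->
          H (s + 1) = H s) &
        large_in_sector alpha beta (fun l : R[i] =>
          let X := cexp (loglam lambda logeta * l) * H (loglam lambda l) in
          f (cexp l) = Psiinv X /\
          series (fun n => psi n.+2
              * cexp (n.+2%:R * loglam lambda logeta * l)
              * H (loglam lambda l) ^+ n.+2)
            @ \oo --> f (cexp l) - (w0 + X))].
Proof.
move=> etaE Psi_hol Psi_eq Psi0 Psi1 [_ _ _ PsiK] psi_near.
pose H s := Psi (f (cexp ((ln lambda)%:C * s))) * cexp (- logeta * s).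
have HE l : cexp (loglam lambda logeta * l) * H (loglam lambda l) = Psi (f (cexp l)).
  rewrite /H ln_lambdaMloglam mulrCA -cexpD.
  rewrite (_ : _ + _ = 0) ?cexp0 ?mulr1 // /loglam; ring.
exists H; split.
- move=> s /strip_scale ss; apply: cderivableM; last first.
    by apply: (@cderivable_comp _ (fun w => - logeta * w));
      [exact: cderivable_scale|exact: cderivable_cexp].
  apply: (@cderivable_comp _ (f \o (@cexp R \o (fun w => (ln lambda)%:C * w)))); last first.
    by apply: Psi_hol; exact: sector_f_basin.
  apply: cderivable_comp; last exact: f_entire.
  by apply: cderivable_comp; [exact: cderivable_scale|exact: cderivable_cexp].
- move=> s /strip_scale ss; rewrite /H !mulrDr !mulr1 cexpD_ln f_eq -Psi_eq; last first.
    exact: sector_f_basin.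
  rewrite cexpD cexpN etaE; have eta0 : eta != 0 by rewrite -etaE cexp_neq0.
  by field.
have Psi_c : {for w0, continuous Psi}.
  exact: cderivable_continuous (has_cderiv_cderivable Psi1).
pose Q w := series (fun n => psi n.+2 * w ^+ n.+2) @ \oo --> Psiinv w - (w0 + w).
have psi_near' : \forall z \near w0, Q (Psi z).
  by apply: near_continuous_comp Psi_c _; rewrite Psi0.
move=> a b aa bb.
have [M1 M1P] := large_in_sector_near PsiK aa bb.
have [M2 M2P] := large_in_sector_near psi_near' aa bb.
exists (Num.max M1 M2) => l ls lM.
have /(M1P l ls) K : M1%:C < `|cexp l| by rewrite (le_lt_trans _ lM) // lecR le_max lexx.
have /(M2P l ls) S : M2%:C < `|cexp l| by rewrite (le_lt_trans _ lM) // lecR le_max lexx orbT.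
cbv zeta; rewrite HE; split; first by rewrite K.
have -> : (fun n => psi n.+2 * cexp (n.+2%:R * loglam lambda logeta * l)
    * H (loglam lambda l) ^+ n.+2) = (fun n => psi n.+2 * Psi (f (cexp l)) ^+ n.+2).
  apply/funext => n; rewrite -(HE l) -(mulrA n.+2%:R) cexpMn.
  move: (cexp (loglam lambda logeta * l)) (H _) => x y.
  rewrite -mulrA -exprMn.
  reflexivity.
by move: S; rewrite /Q K.
Qed.

Lemma large_in_sectorS (a b : R) (Q1 Q2 : R[i] -> Prop) :
  (forall l, Q1 l -> Q2 l) -> large_in_sector a b Q1 -> large_in_sector a b Q2.
Proof.
by move=> Q12 Q1P a' b' aa bb; have [M MP] := Q1P _ _ aa bb; exists M => l ls /(MP l ls) /Q12.
Qed.

Lemma large_in_sectorI (a b : R) (Q1 Q2 : R[i] -> Prop) :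
  large_in_sector a b Q1 -> large_in_sector a b Q2 ->
  large_in_sector a b (fun l => Q1 l /\ Q2 l).
Proof.
move=> Q1P Q2P a' b' aa bb.
have [M1 M1P] := Q1P _ _ aa bb; have [M2 M2P] := Q2P _ _ aa bb.
exists (Num.max M1 M2) => l ls lM; split; [apply: M1P|apply: M2P] => //.
  by rewrite (le_lt_trans _ lM) // lecR le_max lexx.
by rewrite (le_lt_trans _ lM) // lecR le_max lexx orbT.
Qed.

Lemma large_in_sector_Re (a b : R) :
  large_in_sector a b (fun l : R[i] => 0 <= complex.Re l).
Proof.
move=> a' b' _ _; exists 1 => l _; rewrite norm_cexp ltcR -[X in X < _]expR0.
by rewrite ltr_expR => /ltW.
Qed.

Lemma near_remainder_le (g : R[i] -> R[i]) (e : R) : has_cderiv g w0 1 -> g w0 = 0 ->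
  0 < e -> \forall z \near w0, `|z - (w0 + g z)| <= e%:C * `|g z|.
Proof.
move=> /has_cderivP g1 g0 e0; pose e' := Num.min (1 / 2) (e / 2).
have e'0 : 0 < e' by rewrite lt_min !divr_gt0.
have e'1 : e' <= 1 / 2 by rewrite ge_min lexx.
have e'2 : e' <= e / 2 by rewrite ge_min lexx orbT.
have /near_complexP [m m0 mP] := g1 _ e'0.
apply/near_complexP; exists m => // z /mP; rewrite g0 subr0 mul1r.
have -> : z - (w0 + g z) = - (g z - (z - w0)) by ring.
have := ler_normD (g z) (- (g z - (z - w0))).
rewrite (_ : g z + - (g z - (z - w0)) = z - w0); last by ring.
rewrite normrN -(Re_norm_norm (z - w0)) -(Re_norm_norm (g z)).
rewrite -(Re_norm_norm (g z - (z - w0))) -!rmorphM -rmorphD !lecR.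
have : 0 <= complex.Re `|z - w0| by rewrite -ler0c Re_norm_norm.
have : 0 <= complex.Re `|g z| by rewrite -ler0c Re_norm_norm.
move: (complex.Re `|z - w0|) (complex.Re `|g z|) (complex.Re `|g z - (z - w0)|).
move=> x y t y0 x0 h1 h2.
have h3 : e' * x <= 1 / 2 * x by rewrite ler_wpM2r.
have h4 : e' * x <= e / 2 * x by rewrite ler_wpM2r.
have h5 : e / 2 * x <= e / 2 * (2 * y) by rewrite ler_wpM2l ?divr_ge0 ?(ltW e0) //; lra.
lra.
Qed.

Lemma poincare_boettcher (k : nat) (A : R[i]) (g ginv : R[i] -> R[i]) :
  (2 <= k)%N ->
  A != 0 ->
  (\forall z \near w0, g P.[z] = A * g z ^+ k) ->
  g w0 = 0 ->
  has_cderiv g w0 1 ->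
  local_inverse g w0 ginv ->
  exists (B : R[i]) (L : R[i] -> R[i]),
    let X (l : R[i]) := B * cexp (cexp (loglam lambda (ln k%:R)%:C * l)
                         * L (loglam lambda l)) in
    [/\ B ^+ k.-1 = A^-1,
        (forall s : R[i], L (s + 1) = L s),
        large_in_sector alpha beta (fun l : R[i] =>
          f (cexp l) != w0 -> f (cexp l) = ginv (X l)) &
        (forall eps : R, 0 < eps ->
          large_in_sector alpha beta (fun l : R[i] =>
            f (cexp l) != w0 ->
            `|f (cexp l) - (w0 + X l)| <= eps%:C * `|X l|))].
Proof.
move=> k2 A0 g_eq g0 g1 [ginv0 _ _ gK].
have k10 : (0 < k.-1)%N by case: k k2 {g_eq} => [|[]].
pose B := (k.-1).-root A^-1.
have BE : B ^+ k.-1 = A^-1 by exact: rootCK.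
have B0 : B != 0.
  by apply/eqP => B0; move: BE; rewrite B0 expr0n gtn_eqF // => /esym/eqP;
    rewrite invr_eq0 (negPf A0).
have AB : A * B ^+ k = B.
  by rewrite -(prednK (ltnW k2)) exprSr BE mulrA divff // mul1r.
have near_g : \forall z \near w0, g P.[z] = A * g z ^+ k /\ ginv (g z) = z.
  by move/near_complexP: g_eq => [m m0 mP]; move/near_complexP: gK => [n n0 nP];
    apply/near_complexP; exists (Num.min m n); rewrite ?lt_min ?m0 // => z zmn;
    split; [apply: mP|apply: nP]; rewrite (lt_le_trans zmn) // lecR ge_min lexx ?orbT.
have [e e0 eP] := near_invariant_ball Pw0 (is_derive_horner P w0) P_attr near_g.
pose L0 : R[i] := (ln lambda)%:C; pose K (s : R[i]) : R[i] := cexp ((ln k%:R)%:C * s).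
have K1 s : K (s + 1) = k%:R * K s.
  rewrite /K /= mulrDr mulr1 cexpD cexp_real lnK ?posrE ?ltr0n ?(ltnW k2) //.
  by rewrite rmorph_nat mulrC.
pose u l := g (f (cexp l)) / B.
pose good l := [/\ 0 <= complex.Re l, `|f (cexp l) - w0| < e%:C & f (cexp l) != w0].
have g_neq0 z : `|z - w0| < e%:C -> z != w0 -> g z != 0.
  move=> /eP [[_ gz] _]; apply: contra => /eqP gz0.
  by rewrite -gz gz0 ginv0.
have goodD s : good (L0 * s) -> good (L0 * (s + 1)) /\ u (L0 * (s + 1)) = u (L0 * s) ^+ k.
  case=> sRe sball sneq; have [[gP gvg] Pball] := eP _ sball.
  have fE : f (cexp (L0 * (s + 1))) = P.[f (cexp (L0 * s))].
    by rewrite mulrDr mulr1 cexpD_ln f_eq.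
  split; last first.
    rewrite /u fE gP expr_div_n -[in LHS]AB; field.
    by rewrite A0 expf_neq0 // B0.
  split; last 1 first.
  - apply/eqP; rewrite fE => Pw; move: gP; rewrite Pw g0 => /esym/eqP.
    by rewrite mulf_eq0 (negPf A0) /= expf_eq0 (negPf (g_neq0 _ sball sneq)) andbF.
  - move: sRe; rewrite mulrDr mulr1; case: (L0 * s) => x y /= x0.
    by rewrite addr_ge0 // ltW // ln_lambda_gt0.
  - by rewrite fE.
(* V (s + 1) and V s are the same set, so a choice from V s is 1-periodic in s. *)
pose V s := [set v | forall m : int, good (L0 * (s + m%:~R)) ->
  cexp (K (s + m%:~R) * v) = u (L0 * (s + m%:~R))].
have V1 s : V (s + 1) = V s.
  apply/seteqP; split=> v Vv m.
    by have := Vv (m - 1); rewrite intrB -addrA [1 + _]addrC subrK.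
  by have := Vv (m + 1); rewrite intrD [m%:~R + 1]addrC addrA.
have V_neq0 s : exists v, V s v.
  have [[m0 gm0]|no_good] := pselect (exists m : int, good (L0 * (s + m%:~R))); last first.
    by exists 0 => m gm; case: no_good; exists m.
  pose N : int := Num.bound (complex.Re s).
  have good_ge m : good (L0 * (s + m%:~R)) -> exists j : nat, m = j%:Z - N.
    case=> sRe _ _; have mN : 0 <= m + N.
      rewrite -(ler_int R) intrD addrC.
      have sN : complex.Re s < N%:~R by exact: unstable.ltr_bound.
      move: sRe; rewrite (_ : complex.Re _ = ln lambda * (complex.Re s + m%:~R)).
        by rewrite pmulr_rge0 ?ln_lambda_gt0 // => smRe; lra.
      rewrite /L0 -[m%:~R in LHS](rmorph_int (real_complex R)); case: (s) => x y /=.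
      by rewrite mul0r subr0.
    by exists (absz (m + N)); rewrite gez0_abs // addrK.
  have [j0 gj0 j0_min] : exists2 j0 : nat, good (L0 * (s + (j0%:Z - N)%:~R)) &
      forall j : nat, good (L0 * (s + (j%:Z - N)%:~R)) -> (j0 <= j)%N.
    have [j jE] := good_ge _ gm0.
    have exj : exists j, `[<good (L0 * (s + (j%:Z - N)%:~R))>].
      by exists j; apply/asboolP; rewrite -jE.
    exists (ex_minn exj); case: ex_minnP => i /asboolP gi imin // i' gi'.
    by apply: imin; apply/asboolP.
  pose s0 := s + (j0%:Z - N)%:~R.
  have u0 : u (L0 * s0) != 0.
    by case: gj0 => _ lb lw; rewrite mulf_neq0 ?invr_neq0 // g_neq0.
  have [v vE] := cexp_surj u0.
  have Ks0 : K s0 != 0 by exact: cexp_neq0.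
  exists (v / K s0) => m gm; have [j jE] := good_ge _ gm.
  have j0j : (j0 <= j)%N by apply: j0_min; rewrite -jE.
  have -> : s + m%:~R = s0 + (j - j0)%:R.
    rewrite jE /s0 -{1}(subnK j0j) addnC PoszD !intrB !intrD -!pmulrn; ring.
  have : good (L0 * s0) by exact: gj0.
  suff step i : good (L0 * (s0 + i%:R)) /\
      cexp (K (s0 + i%:R) * (v / K s0)) = u (L0 * (s0 + i%:R)) by have [] := step (j - j0)%N.
  elim: i => [|i [gi ih]]; first by rewrite addr0 (mulrC (K s0)) divfK.
  have [gi1 uE] := goodD _ gi.
  by rewrite -natr1 addrA uE K1 -ih -mulrA cexpMn.
pose L s := xget 0 (V s).
have LP s : V s (L s) by exact: (xgetPex 0 (V_neq0 s)).
have XE l : good l -> B * cexp (cexp (loglam lambda (ln k%:R)%:C * l) * L (loglam lambda l))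
    = g (f (cexp l)).
  move=> gl; have := LP (loglam lambda l) 0; rewrite addr0 ln_lambdaMloglam => /(_ gl).
  rewrite /K /= (_ : _ * loglam _ _ = loglam lambda (ln k%:R)%:C * l); last first.
    by rewrite /loglam; ring.
  by move=> ->; rewrite /u mulrC divfK.
have large_ball : large_in_sector alpha beta (fun l =>
    [/\ 0 <= complex.Re l, `|f (cexp l) - w0| < e%:C & ginv (g (f (cexp l))) = f (cexp l)]).
  have ball_near : \forall z \near w0, `|z - w0| < e%:C.
    by apply/near_complexP; exists e.
  apply: (large_in_sectorS _ (large_in_sectorI (large_in_sector_near ball_near)
    (large_in_sector_Re (a := alpha) (b := beta)))) => l [lb l0].
  by split=> //; have [[_ ->]] := eP _ lb.
exists B, L; split=> //.
- by move=> s; rewrite /L V1.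
- by apply: (large_in_sectorS _ large_ball) => l [l0 lb lK] lw; rewrite XE.
move=> eps eps0.
have rem := large_in_sector_near (near_remainder_le g1 g0 eps0).
apply: (large_in_sectorS _ (large_in_sectorI large_ball rem)) => l [[l0 lb lK] lrem] lw.
by rewrite XE.
Qed.

End PoincareFunction.

Theorem theorem2p3 (R : realType) (d : nat) (p : {poly R}) (lambda : R)
    (f : R[i] -> R[i]) (w0 : R[i]) (alpha beta r : R)
    (hd : (2 <= d)%N)
    (hsize : size p = d.+1)
    (hmonic : p \is monic)
    (hp0 : p.[0] = 0)
    (hlambda : lambda = p^`().[0])
    (hlambda1 : 1 < lambda)
    (hf_entire : holomorphic_on setT f)
    (hf_eq : forall z : R[i], f (lambda%:C * z) = (cpoly p).[f z])
    (hf0 : f 0 = 0)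
    (hf1 : has_cderiv f 0 1)
    (hfix : (cpoly p).[w0] = w0)
    (hattr : `|(cpoly p)^`().[w0]| < 1)
    (hab : alpha < beta)
    (hr : 0 < r)
    (hbasin : forall z : R[i], sector alpha beta z -> `|z| < r%:C ->
      basin (cpoly p) w0 z) :
  (forall (eta logeta : R[i]) (Psi Psiinv : R[i] -> R[i]) (psi : nat -> R[i]),
      eta = (cpoly p)^`().[w0] ->
      eta != 0 ->
      cexp logeta = eta ->
      holomorphic_on (basin (cpoly p) w0) Psi ->
      (forall z : R[i], basin (cpoly p) w0 z -> eta * Psi z = Psi (cpoly p).[z]) ->
      Psi w0 = 0 ->
      has_cderiv Psi w0 1 ->
      local_inverse Psi w0 Psiinv ->
      (\forall w \near (0 : R[i]),
        series (fun n => psi n.+2 * w ^+ n.+2) @ \oo --> Psiinv w - (w0 + w)) ->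
      exists H : R[i] -> R[i],
        [/\ holomorphic_on (strip (alpha / ln lambda) (beta / ln lambda)) H,
            (forall s : R[i], strip (alpha / ln lambda) (beta / ln lambda) s ->
              H (s + 1) = H s) &
            large_in_sector alpha beta (fun l : R[i] =>
              let X := cexp (loglam lambda logeta * l) * H (loglam lambda l) in
              f (cexp l) = Psiinv X /\
              series (fun n => psi n.+2
                  * cexp (n.+2%:R * loglam lambda logeta * l)
                  * H (loglam lambda l) ^+ n.+2)
                @ \oo --> f (cexp l) - (w0 + X))])
  /\
  (forall (k : nat) (P : {poly R[i]}) (A : R[i]) (g ginv : R[i] -> R[i]),
      (2 <= k)%N ->
      cpoly p - w0%:P = ('X - w0%:P) ^+ k * P ->
      A = P.[w0] ->
      A != 0 ->
      (\forall z \near w0, cderivable g z) ->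
      (\forall z \near w0, g (cpoly p).[z] = A * g z ^+ k) ->
      g w0 = 0 ->
      has_cderiv g w0 1 ->
      local_inverse g w0 ginv ->
      exists (B : R[i]) (L : R[i] -> R[i]),
        let X (l : R[i]) := B * cexp (cexp (loglam lambda (ln k%:R)%:C * l)
                             * L (loglam lambda l)) in
        [/\ B ^+ k.-1 = A^-1,
            (forall s : R[i], strip (alpha / ln lambda) (beta / ln lambda) s ->
              L (s + 1) = L s),
            large_in_sector alpha beta (fun l : R[i] =>
              f (cexp l) != w0 -> f (cexp l) = ginv (X l)) &
            (forall eps : R, 0 < eps ->
              large_in_sector alpha beta (fun l : R[i] =>
                f (cexp l) != w0 ->
                `|f (cexp l) - (w0 + X l)| <= eps%:C * `|X l|))]).
Proof.
split.
  move=> eta logeta Psi Psiinv psi _ _.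
  exact: (poincare_schroeder hlambda1 hf_entire hf_eq hf0 hf1 hfix hattr hr hbasin).
move=> k P A g ginv k2 _ _ A0 _ g_eq g0 g1 ginvP.
have [B [L [BE L1 X1 X2]]] :=
  poincare_boettcher hlambda1 hf_entire hf_eq hf0 hf1 hfix hattr hr hbasin k2 A0 g_eq g0 g1 ginvP.
by exists B, L; split.
Qed.
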